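(* Let $\mathcal{H}$ and $\mathcal{G}$ be real Hilbert spaces, let $L\colon\mathcal{H}\to\mathcal{G}$ be a bounded linear operator with $\|L\|\leq 1$, let $B\colon\mathcal{G}\to 2^{\mathcal{G}}$ be maximally monotone, and let $\gamma\in(0,+\infty)$. For a set-valued operator $A$ on a real Hilbert space, let $F_A$ denote its Fitzpatrick function. Then the following hold: (i) Let $x\in\ker(\mathrm{Id}_{\mathcal{H}}-L^*\circ L)$ and $x^*\in\mathcal{H}$. Then $F_{\gamma(L\overset{\gamma}{\diamond}B)}(x,x^* )\leq F_{\gamma B}(Lx,Lx^* )$. (ii) Let $x\in\mathcal{H}$ and $x^*\in\ker(\mathrm{Id}_{\mathcal{H}}-L^*\circ L)$. Then $F_{\gamma(L\overset{\gamma}{\bullet}B)}(x,x^* )\leq F_{\gamma B}(Lx,Lx^* )$.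
   Context: A set-valued operator $A\colon\mathcal{H}\to2^{\mathcal{H}}$ has graph $\operatorname{gra}A=\{(x,x^* )\mid x^*\in Ax\}$; it is maximally monotone if it is monotone ($\langle x_1-x_2\mid x_1^*-x_2^*\rangle\geq 0$ for all $(x_1,x_1^* ),(x_2,x_2^* )\in\operatorname{gra}A$) and its graph is not properly contained in the graph of another monotone operator. The Fitzpatrick function of $A$ is $F_A\colon\mathcal{H}\times\mathcal{H}\to[-\infty,+\infty]$, $F_A(x,x^* )=\sup_{(v,v^* )\in\operatorname{gra}A}\bigl(\langle v\mid x^*\rangle+\langle x\mid v^*\rangle-\langle v\mid v^*\rangle\bigr)$. $A^{-1}$ is defined by $x\in A^{-1}x^*\Leftrightarrow x^*\in Ax$. Sums, scalar multiples and compositions are pointwise, e.g. $(L^*\circ C\circ L)x=\{L^*y\mid y\in C(Lx)\}$. For a bounded linear $L\colon\mathcal{H}\to\mathcal{G}$ with adjoint $L^*$ and $C\colon\mathcal{G}\to2^{\mathcal{G}}$, the parallel composition is $L^*\triangleright C=(L^*\circ C^{-1}\circ L)^{-1}\colon\mathcal{H}\to2^{\mathcal{H}}$. For $\gamma>0$, the resolvent composition is $L\overset{\gamma}{\diamond}C=L^*\triangleright(C+\gamma^{-1}\mathrm{Id}_{\mathcal{G}})-\gamma^{-1}\mathrm{Id}_{\mathcal{H}}\colon\mathcal{H}\to2^{\mathcal{H}}$, and the resolvent cocomposition is $L\overset{\gamma}{\bullet}C=(L\overset{1/\gamma}{\diamond}C^{-1})^{-1}\colon\mathcal{H}\to2^{\mathcal{H}}$.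 *)

(* Defs.v *)
From HB Require Import structures.
From mathcomp Require Import all_boot all_order all_algebra.
From mathcomp Require Import all_classical all_reals all_analysis.

Set Implicit Arguments.
Unset Strict Implicit.
Unset Printing Implicit Defensive.

Import Order.TTheory GRing.Theory Num.Theory.
Import numFieldNormedType.Exports.

Local Open Scope classical_set_scope.
Local Open Scope ring_scope.

HB.mixin Record CompleteNormedModule_isHilbert (R : realType) H
    of CompleteNormedModule R H := {
  hdot : {dot H for idfun} ;
  sqr_norm_hdot : forall x : H, `|x| ^+ 2 = hdot x x
}.

#[short(type="hilbertType")]
HB.structure Definition Hilbert (R : realType) :=
  {H of CompleteNormedModule_isHilbert R H & CompleteNormedModule R H}.

Notation "'[ u , v ]" := (hdot u v) : ring_scope.

Section BoundedOperators.
Context (R : realType) (H G : hilbertType R).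

(* `sup` is 0 on unbounded sets, so this is the operator norm only for
   bounded L. *)
Definition opnorm (L : H -> G) : R :=
  sup [set `|L x| | x in [set x : H | `|x| <= 1]].

(* For a bounded linear L, the Riesz representation theorem provides, for each
   y, exactly one h as below; the default value 0 is then never used. *)
Definition adjoint (L : H -> G) (y : G) : H :=
  xget 0 [set h : H | forall x : H, '[L x, y] = '[x, h]].

End BoundedOperators.

Definition ker (R : realType) (H G : hilbertType R) (T : H -> G) : set H :=
  T @^-1` [set 0].

Section SetValuedOperators.
Context (R : realType) (H : hilbertType R).
Implicit Types A C : H -> set H.

Definition gra A : set (H * H) := [set z | A z.1 z.2].

Definition monotone A : Prop :=
  forall z1 z2, gra A z1 -> gra A z2 -> 0 <= '[z1.1 - z2.1, z1.2 - z2.2].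

Definition maximally_monotone A : Prop :=
  monotone A /\ ~ exists A', monotone A' /\ gra A `<` gra A'.

Definition fitzpatrick A (x xs : H) : \bar R :=
  ereal_sup [set ('[z.1, xs] + '[x, z.2] - '[z.1, z.2])%:E | z in gra A].

Definition op_id : H -> set H := fun x => [set x].

Definition op_inv A : H -> set H := fun xs => [set x | A x xs].

Definition op_add A C : H -> set H :=
  fun x => [set a + c | a in A x & c in C x].

Definition op_sub A C : H -> set H :=
  fun x => [set a - c | a in A x & c in C x].

Definition op_scale (c : R) A : H -> set H :=
  fun x => [set c *: a | a in A x].

End SetValuedOperators.

Arguments op_id {R H}.

Section Compositions.
Context (R : realType) (H G : hilbertType R).
Implicit Types (L : H -> G) (C : G -> set G).

Definition op_sandwich L C : H -> set H := fun x => adjoint L @` C (L x).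

(* the parallel composition of C by the adjoint of L *)
Definition parallel_comp L C : H -> set H :=
  op_inv (op_sandwich L (op_inv C)).

Definition resolvent_comp (gamma : R) L C : H -> set H :=
  op_sub (parallel_comp L (op_add C (op_scale gamma^-1 op_id)))
         (op_scale gamma^-1 op_id).

Definition resolvent_cocomp (gamma : R) L C : H -> set H :=
  op_inv (resolvent_comp gamma^-1 L (op_inv C)).

End Compositions.

(* Main.v *)
(* Rescaling by gamma, the graph of gamma (L <> B) consists of the pairs
   (L^* y, p - L^* y) with (y, L p - y) in the graph of gamma B, and the graph
   of gamma (L o B) of the pairs (p - L^* y, L^* y) with (L p - y, y) in the
   graph of gamma B.  When L^* L fixes the relevant argument, the Fitzpatrick
   terms of corresponding pairs differ by |y|^2 - |L^* y|^2, which is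
   nonnegative since |L^*| <= 1.  The adjoint identity itself rests on the Riesz
   representation theorem, obtained by minimizing |x|^2 - 2 f x. *)
Require Import Defs.
From mathcomp Require Import all_boot all_order all_algebra.
From mathcomp Require Import all_classical all_reals all_analysis.
From mathcomp Require Import ring lra.
Import Order.TTheory GRing.Theory Num.Theory.
Import numFieldNormedType.Exports.
Local Open Scope classical_set_scope.
Local Open Scope ring_scope.

(** Evaluate at the vertex [t = - b / a]. When [a = 0] the function is affine in [t], and a nonzero
    [b] would let it take the value -1. *)
Lemma quadratic_ge0_discr (R : realFieldType) (a b c : R) : 0 <= a ->
  (forall t, 0 <= c + 2 * t * b + t ^+ 2 * a) -> b ^+ 2 <= c * a.
Proof.
rewrite le_eqVlt => /predU1P[<- h|a0 h].
  have [->|b0] := eqVneq b 0; first by rewrite mulr0 expr0n.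
  have := h (- (c + 1) / (2 * b)).
  suff -> : c + 2 * (- (c + 1) / (2 * b)) * b + (- (c + 1) / (2 * b)) ^+ 2 * 0
    = - 1 by rewrite lerNr oppr0 ler10.
  by field.
have := h (- b / a).
have -> : c + 2 * (- b / a) * b + (- b / a) ^+ 2 * a = (c * a - b ^+ 2) / a.
  by field; rewrite gt_eqF.
by rewrite pmulr_lge0 ?invr_gt0// subr_ge0.
Qed.

Section InnerProduct.
Context (R : realType) (H : hilbertType R).
Implicit Types (a : R) (x y z : H).

Lemma hdotC x y : '[x, y] = '[y, x].
Proof. by rewrite hermC expr0 mul1r. Qed.

Lemma hdotDl x y z : '[x + y, z] = '[x, z] + '[y, z].
Proof. exact: linearDl. Qed.

Lemma hdotDr x y z : '[z, x + y] = '[z, x] + '[z, y].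
Proof. exact: linearDr. Qed.

Lemma hdotBl x y z : '[x - y, z] = '[x, z] - '[y, z].
Proof. exact: linearBl. Qed.

Lemma hdotBr x y z : '[z, x - y] = '[z, x] - '[z, y].
Proof. exact: linearBr. Qed.

Lemma hdotZl a x y : '[a *: x, y] = a * '[x, y].
Proof. exact: linearZl_LR. Qed.

Lemma hdotZr a x y : '[x, a *: y] = a * '[x, y].
Proof. exact: linearZr_LR. Qed.

Lemma sqr_normD x y : `|x + y| ^+ 2 = `|x| ^+ 2 + 2 * '[x, y] + `|y| ^+ 2.
Proof.
by rewrite !sqr_norm_hdot !hdotDl !hdotDr (hdotC y x); ring.
Qed.

Lemma sqr_normDZ a x y :
  `|x + a *: y| ^+ 2 = `|x| ^+ 2 + 2 * a * '[x, y] + a ^+ 2 * `|y| ^+ 2.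
Proof. by rewrite sqr_normD hdotZr !sqr_norm_hdot hdotZl hdotZr; ring. Qed.

Lemma hdot_cauchy_schwarz x y : `|'[x, y]| <= `|x| * `|y|.
Proof.
rewrite -(@ler_pXn2r _ 2)// ?nnegrE ?mulr_ge0// exprMn.
have -> : `|'[x, y]| ^+ 2 = '[x, y] ^+ 2 by rewrite real_normK ?num_real.
apply: quadratic_ge0_discr => [|t]; first exact: exprn_ge0.
by rewrite -sqr_normDZ exprn_ge0.
Qed.

Lemma hdot_eqr x y : (forall z, '[z, x] = '[z, y]) -> x = y.
Proof.
move=> xy; apply/eqP; rewrite -subr_eq0 -normr_eq0 -sqrf_eq0.
by rewrite sqr_norm_hdot hdotBr xy subrr.
Qed.

(** * Riesz representation *)

Section Riesz.
Variables (f : H -> R) (M : R).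
Hypotheses (f_lin : scalar f) (f_bound : forall x, `|f x| <= M * `|x|).

Let fD x y : f (x + y) = f x + f y.
Proof. by rewrite -{1}(scale1r x) f_lin mul1r. Qed.

Let fZ a x : f (a *: x) = a * f x.
Proof.
have f0 : f 0 = 0 by apply: (@addIr _ (f 0)); rewrite -fD !add0r.
by rewrite -{1}(addr0 (a *: x)) f_lin f0 addr0.
Qed.

(** If [f] is represented by [h], this is [|x - h|^2 - |h|^2], whose minimizer is [h]. *)
Let J x := `|x| ^+ 2 - 2 * f x.

Let m := inf (range J).

Let J_ge x : m <= J x.
Proof.
apply: ge_inf; last by exists x.
(* The lower bound comes from completing the square in [|z|^2 - 2 M |z|]. *)
exists (- M ^+ 2) => _ [z _ <-]; rewrite /J.
have : f z <= M * `|z| by rewrite (le_trans (ler_norm _)).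
by have := sqr_ge0 (`|z| - M); nra.
Qed.

Let J_approx e : 0 < e -> exists x, J x < m + e.
Proof.
move=> e0; have [] := @inf_adherent _ (range J) e e0; last first.
  by move=> _ [x _ <-] ?; exists x.
split; first by exists (J 0), 0.
by exists m => _ [x _ <-].
Qed.

(** The value of [J] at the midpoint is the mean of [J x] and [J y] minus [|x - y|^2 / 4], yet at
    least [m]. Hence minimizing sequences are Cauchy. *)
Let J_parallelogram x y e :
  J x < m + e -> J y < m + e -> `|x - y| ^+ 2 < 4 * e.
Proof.
move=> Jx Jy; have := J_ge (x + 2^-1 *: (y - x)).
have xyE : `|x - y| = `|y - x| by rewrite distrC.
have -> : J (x + 2^-1 *: (y - x)) = (J x + J y) / 2 - `|x - y| ^+ 2 / 4.
  (* With [y] written this way, [y] and the midpoint both expand along the direction [y - x]. *)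
  rewrite /J; have yE : y = x + 1 *: (y - x) by rewrite scale1r addrC subrK.
  rewrite xyE [in X in _ = (_ + (X - _)) / _ - _]yE [in 2 * f y]yE.
  by rewrite !sqr_normDZ !fD !fZ; field.
by lra.
Qed.

(** First-order condition with an error: [J (x + t *: z) >= m > J x - e] for all [t], so a quadratic
    in [t] with constant term [e] is nonnegative. *)
Let J_almost_critical x z e :
  J x < m + e -> ('[x, z] - f z) ^+ 2 <= e * `|z| ^+ 2.
Proof.
move=> Jx; apply: quadratic_ge0_discr => [|t]; first exact: exprn_ge0.
have := J_ge (x + t *: z); rewrite /J sqr_normDZ fD fZ.
by move: Jx; rewrite /J; lra.
Qed.

Lemma riesz_representation : exists h, forall x, f x = '[x, h].
Proof.
have /choice[u uP] (n : nat) : exists x, J x < m + n.+1%:R^-1.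
  exact: J_approx.
have small e : 0 < e -> exists N : nat, forall n, (N <= n)%N ->
    J (u n) < m + e.
  move=> e0; have := @near_infty_natSinv_lt R (PosNum e0).
  case=> N _ NP; exists N => n Nn; apply: lt_trans (uP n) _.
  by rewrite ltrD2l; exact: NP.
have : cvg (u @ \oo).
  apply: cauchy_cvg; apply/cauchyP => e e0.
  (* [J_parallelogram] multiplies this by 4, giving a squared distance below [e ^+ 2]. *)
  have [|N NP] := small (e ^+ 2 / 4); first by rewrite divr_gt0 ?exprn_gt0.
  exists (u N); exists N => // n /= Nn; rewrite -ball_normE /=.
  rewrite -(@ltr_pXn2r _ 2)// ?nnegrE ?normr_ge0// ?ltW//.
  have := J_parallelogram _ _ _ (NP _ (leqnn N)) (NP _ Nn).
  by rewrite mulrC divfK.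
move=> /cvg_ex[/= h uh]; exists h => z; rewrite hdotC.
apply/eqP; rewrite eq_sym -subr_eq0 -normr_le0; apply/ler_addgt0Pr => e e0.
(* Replacing [h] by [u n] and the criticality defect of [u n] each cost at most [d * |z|], together
   at most [e]. The [+ 1] covers [z = 0]. *)
rewrite add0r; pose d := e / (2 * (`|z| + 1)).
have z1 : 0 < `|z| + 1 by rewrite ltr_wpDl.
have d0 : 0 < d by rewrite divr_gt0// mulr_gt0.
have [N1 N1P] := small _ (exprn_gt0 2 d0).
have [N2 _ N2P] : \forall n \near \oo, `|h - u n| < d.
  by move/cvgr_dist_lt: uh; exact.
pose n := maxn N1 N2.
have hn : `|h - u n| < d by apply: N2P; rewrite /= leq_maxr.
have cn : `|'[u n, z] - f z| <= d * `|z|.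
  have dz0 : 0 <= d * `|z| by rewrite mulr_ge0// ltW.
  rewrite -(@ler_pXn2r _ 2)// exprMn.
  rewrite real_normK ?num_real//.
  by apply: J_almost_critical; apply: N1P; rewrite leq_maxl.
have -> : '[h, z] - f z = '[h - u n, z] + ('[u n, z] - f z).
  by rewrite hdotBl; ring.
rewrite (le_trans (ler_normD _ _))//.
have := hdot_cauchy_schwarz (h - u n) z.
have : `|h - u n| * `|z| <= d * `|z| by rewrite ler_wpM2r// ltW.
have : e = d * (2 * (`|z| + 1)) by rewrite /d divfK// gt_eqF// mulr_gt0.
by nra.
Qed.

End Riesz.

End InnerProduct.

Section Adjoint.
Context (R : realType) (H G : hilbertType R) (L : {linear H -> G}).
Hypothesis L_bounded : bounded_near L (nbhs (0 : H)).

Lemma bounded_near_lipschitz : exists M, forall x, `|L x| <= M * `|x|.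
Proof.
by move/linear_boundedP: L_bounded => /pinfty_ex_gt0[M _ ?]; exists M.
Qed.

Lemma ler_opnorm x : `|L x| <= opnorm L * `|x|.
Proof.
have [->|x0] := eqVneq x 0; first by rewrite linear0 !normr0 mulr0.
have nx : 0 < `|x| by rewrite normr_gt0.
rewrite -ler_pdivrMr//.
have -> : `|L x| / `|x| = `|L (`|x|^-1 *: x)|.
  by rewrite linearZ normrZ ger0_norm ?invr_ge0// mulrC.
apply: ub_le_sup; last first.
  by exists (`|x|^-1 *: x) => //=; rewrite normrZ normfV normr_id mulVf ?gt_eqF.
(* [sup] bounds the set only once the set is known to be bounded above; the sign of [M] is unknown,
   hence [|M|]. *)
have [M LM] := bounded_near_lipschitz; exists `|M| => _ [z /= z1 <-].
apply: le_trans (LM z) _; apply: le_trans (ler_norm _) _.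
by rewrite normrM normr_id ler_piMr.
Qed.

(** Riesz applied to [z |-> '[L z, y]] gives a point of the set in [adjoint], so [xget] does not
    return its default. *)
Lemma adjointP x y : '[L x, y] = '[x, adjoint L y].
Proof.
have [M LM] := bounded_near_lipschitz.
have [||h hP] := @riesz_representation R H (fun z => '[L z, y]) (M * `|y|).
- by move=> a u v; rewrite linearP hdotDl hdotZl.
- move=> z; apply: le_trans (hdot_cauchy_schwarz _ _ _ _) _.
  by rewrite mulrAC ler_wpM2r.
by rewrite /adjoint; case: xgetP => [g _ -> //|/(_ h)].
Qed.

Lemma adjointZ a y : adjoint L (a *: y) = a *: adjoint L y.
Proof. by apply: hdot_eqr => z; rewrite hdotZr -!adjointP hdotZr. Qed.

(** With [w = adjoint L y], [|w|^2 = '[L w, y] <= |L w| |y| <= |w| |y|]; then cancel [|w|]. *)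
Lemma norm_adjoint_le y : opnorm L <= 1 -> `|adjoint L y| <= `|y|.
Proof.
move=> L1; have [->|y0] := eqVneq (adjoint L y) 0; first by rewrite normr0.
rewrite -(@ler_pM2l _ `|adjoint L y|) ?normr_gt0// -expr2 sqr_norm_hdot.
rewrite -adjointP; apply: le_trans (ler_norm _) _.
apply: le_trans (hdot_cauchy_schwarz _ _ _ _) _; rewrite ler_wpM2r//.
by apply: le_trans (ler_opnorm _) _; rewrite ler_piMl.
Qed.

End Adjoint.

Lemma le_fitzpatrick (R : realType) (H G : hilbertType R)
    (A : H -> set H) (C : G -> set G) (x xs : H) (y ys : G) :
  (forall v vs, A v vs -> exists w ws, C w ws /\
     '[v, xs] + '[x, vs] - '[v, vs] <= '[w, ys] + '[y, ws] - '[w, ws]) ->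
  (fitzpatrick A x xs <= fitzpatrick C y ys)%E.
Proof.
move=> AC; apply: ge_ereal_sup => _ [[v vs] /= /AC[w [ws [Cw le_vw]]] <-].
apply: le_trans (ereal_sup_ubound _); last by exists (w, ws); first exact: Cw.
by rewrite lee_fin.
Qed.

(** * Parametrization of the graphs of the two compositions *)

Section Graphs.
Context (R : realType) (H G : hilbertType R) (L : {linear H -> G}).
Hypothesis L_bounded : bounded_near L (nbhs (0 : H)).
Variables (B : G -> set G) (gamma : R).
Hypothesis gamma_gt0 : 0 < gamma.

Lemma op_scale_resolvent_comp_sub v vs :
  op_scale gamma (resolvent_comp gamma L B) v vs ->
  exists y p, [/\ op_scale gamma B y (L p - y), v = adjoint L y
    & vs = p - adjoint L y].
Proof.
have gK : gamma * gamma^-1 = 1 by rewrite divff ?gt_eqF.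
move=> [_ [a [y]]] [b Bb] [_ [_ -> <-] Lp <- [_ [_ -> <-] <-] <-].
(* Here [L a = b + gamma^-1 *: y] with [b] in [B y]; multiplying by [gamma] gives [p = gamma *: a]
   and [L p - y = gamma *: b]. *)
exists y, (gamma *: a); split=> //.
  by exists b => //; rewrite linearZ -Lp /= scalerDr scalerA gK scale1r addrK.
by rewrite scalerBr scalerA gK scale1r.
Qed.

Lemma op_scale_resolvent_cocomp_sub v vs :
  op_scale gamma (resolvent_cocomp gamma L B) v vs ->
  exists y p, [/\ op_scale gamma B (L p - y) y, v = p - adjoint L y
    & vs = adjoint L y].
Proof.
move=> [_ [a [y]]] [b Bb] [_ [_ -> <-] Lp <- [_ [_ -> <-] <-] <-].
(* Here [L a = b + gamma *: y] with [y] in [B b], so the scaling falls on [y] and passes through the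
   adjoint. *)
exists (gamma *: y), a; rewrite invrK adjointZ//; split=> //.
by exists y => //; rewrite -Lp invrK addrK.
Qed.

End Graphs.

Theorem proposition4p16 (R : realType) (H G : hilbertType R)
    (L : {linear H -> G}) (L_bounded : bounded_near L (nbhs (0 : H)))
    (L_le1 : opnorm L <= 1)
    (B : G -> set G) (B_maxmon : maximally_monotone B)
    (gamma : R) (gamma_gt0 : 0 < gamma) :
  (forall x xs : H, x \in ker (fun z : H => z - adjoint L (L z)) ->
     (fitzpatrick (op_scale gamma (resolvent_comp gamma L B)) x xs
        <= fitzpatrick (op_scale gamma B) (L x) (L xs))%E) /\
  (forall x xs : H, xs \in ker (fun z : H => z - adjoint L (L z)) ->
     (fitzpatrick (op_scale gamma (resolvent_cocomp gamma L B)) x xs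
        <= fitzpatrick (op_scale gamma B) (L x) (L xs))%E).
Proof.
(* The pairing with [p] is the only Fitzpatrick term below that contains no adjoint; substituting
   [adjoint L (L x)] for [x] moves it to [G]. *)
have kerE (x p : H) : x \in ker (fun z => z - adjoint L (L z)) ->
    '[p, x] = '[L p, L x].
  by rewrite inE /ker /= => /subr0_eq {1}->; rewrite adjointP.
have adj_le y : '[adjoint L y, adjoint L y] <= '[y, y].
  by rewrite -!sqr_norm_hdot ler_pXn2r ?nnegrE//; exact: norm_adjoint_le.
split=> x xs kx; apply: le_fitzpatrick => v vs.
  move=> /(op_scale_resolvent_comp_sub _ _ _ _ _ _ gamma_gt0)[y [p [Bp -> ->]]].
  exists y, (L p - y); split=> //.
  have := adj_le y; rewrite !hdotBr (hdotC _ _ x p) (kerE x p kx).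
  rewrite ![in X in _ -> X <= _](hdotC _ _ (adjoint L y)) -!adjointP//.
  by rewrite (hdotC _ _ y (L xs)) (hdotC _ _ y (L p)) (hdotC _ _ (L x) (L p))
    adjointP//; lra.
move=> /(op_scale_resolvent_cocomp_sub _ _ _ _ L_bounded)[y [p [Bp -> ->]]].
exists (L p - y), y; split=> //.
(* Now [p] sits in the first component of the pair, so it meets [xs], and the kernel condition is
   used there. *)
have := adj_le y; rewrite !hdotBl (kerE xs p kx).
by rewrite (hdotC _ _ (adjoint L y) xs) -!adjointP// (hdotC _ _ y (L xs)); lra.
Qed.
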